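(* Let $\Gamma\subseteq\mathbb{R}^d$ be a $d$-dimensional lattice, and let $f(m)$ denote the number of distinct coincidence site lattices of $\Gamma$ of index $m$ in $\Gamma$. Then $f$ is supermultiplicative, i.e. $f(mn)\ge f(m)f(n)$ for all coprime positive integers $m$ and $n$.
   Context: Let $\Gamma\subseteq\mathbb{R}^d$ be a lattice of full rank $d$. A linear isometry $R\in\mathrm{O}(d)$ is a coincidence isometry of $\Gamma$ if $\Gamma(R):=\Gamma\cap R\Gamma$ has finite index in $\Gamma$; in this case $\Gamma(R)$ is called an (ordinary) coincidence site lattice (CSL) of $\Gamma$, and its index is $\Sigma(R):=[\Gamma:\Gamma(R)]$. For $m\in\mathbb{N}=\{1,2,\dots\}$, $f(m)$ is the number of distinct sublattices of $\Gamma$ of the form $\Gamma(R)$, with $R$ a coincidence isometry of $\Gamma$ and $\Sigma(R)=m$. *)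

(* Defs.v *)
From HB Require Import structures.
From mathcomp Require Import all_boot all_order all_algebra finmap.
From mathcomp Require Import all_classical reals.

Set Implicit Arguments.
Unset Strict Implicit.
Unset Printing Implicit Defensive.

Import Order.TTheory GRing.Theory Num.Theory.

Local Open Scope classical_set_scope.
Local Open Scope ring_scope.

(* The columns of B are an R-basis of R^d, and G is the set of their integer
   linear combinations. *)
Definition is_lattice (R : realType) (d : nat) (G : set 'cV[R]_d) : Prop :=
  exists2 B : 'M[R]_d, B \in unitmx &
    G = [set B *m map_mx intr z | z in [set: 'cV[int]_d]].

Definition isometry_mx (R : realType) (d : nat) (Q : 'M[R]_d) : Prop :=
  Q^T *m Q = 1%:M.

Definition cosets (V : zmodType) (G H : set V) : set (set V) :=
  [set [set x + y | y in H] | x in G].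

Definition finite_index (V : zmodType) (G H : set V) : Prop :=
  finite_set (cosets G H).

(* [G : H]; [fset_set] sends infinite sets to the empty set, so this is 0 when
   the index is infinite. *)
Definition index_in (V : zmodType) (G H : set V) : nat :=
  #|` fset_set (cosets G H)|%fset.

Definition coincidence_site (R : realType) (d : nat) (G : set 'cV[R]_d)
    (Q : 'M[R]_d) : set 'cV[R]_d :=
  G `&` [set Q *m x | x in G].

Definition coincidence_isometry (R : realType) (d : nat) (G : set 'cV[R]_d)
    (Q : 'M[R]_d) : Prop :=
  isometry_mx Q /\ finite_index G (coincidence_site G Q).

Definition Sigma_index (R : realType) (d : nat) (G : set 'cV[R]_d)
    (Q : 'M[R]_d) : nat :=
  index_in G (coincidence_site G Q).

Definition csl_of_index (R : realType) (d : nat) (G : set 'cV[R]_d) (m : nat) :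
    set (set 'cV[R]_d) :=
  [set coincidence_site G Q |
    Q in [set Q | coincidence_isometry G Q /\ Sigma_index G Q = m]].

(* For a lattice G and m > 0 the set counted here is finite: a subgroup of index
   m contains m G, and G / m G is finite. *)
Definition csl_count (R : realType) (d : nat) (G : set 'cV[R]_d) (m : nat) :
    nat :=
  #|` fset_set (csl_of_index G m)|%fset.

(* Main.v *)
(* The key identity is G ∩ PQG = (G ∩ PG) ∩ P(G ∩ QG) for coincidence isometries
   P, Q whose indices m, n are coprime: P preserves volumes, so G ∩ PG has index m
   in PG as well as in G, and any x in G ∩ PQG has both m x and n x in PG.
   Consequently G ∩ PQG has index m n. It determines
   G ∩ PG = {x in G | n x in G ∩ PQG} and then, once a P has been fixed for each
   value of G ∩ PG, also G ∩ QG = {x in G | m P x in G ∩ PQG}. *)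
Require Import Defs.
From mathcomp Require Import all_boot all_order all_algebra finmap zify.
From mathcomp Require Import all_classical reals.

Set Implicit Arguments.
Unset Strict Implicit.
Unset Printing Implicit Defensive.

Import Order.TTheory GRing.Theory Num.Theory.

Local Open Scope classical_set_scope.
Local Open Scope ring_scope.

(** * Subgroups of an abelian group, coset representatives and indices *)

Definition is_subgroup {V : zmodType} (H : set V) : Prop :=
  H 0 /\ forall x y, H x -> H y -> H (x - y).

(** The first conjunct excludes the default value [0] that [index_in] takes when there are
    infinitely many cosets. *)
Definition has_index {V : zmodType} (G H : set V) (m : nat) : Prop :=
  finite_index G H /\ index_in G H = m.

(** Indexing the representatives by a type turns an index into the cardinal of [T] when [T] is
    finite, so that later counting avoids [fset_set]. *)
Definition transversal {V : zmodType} {T : Type} (r : T -> V) (G H : set V) :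
    Prop :=
  [/\ forall i, G (r i), forall i j, H (r i - r j) -> i = j &
      forall x, G x -> exists i, H (x - r i)].

Section Index.
Variable V : zmodType.
Implicit Types (G H K : set V) (x y : V).

Lemma is_subgroupN H x : is_subgroup H -> H x -> H (- x).
Proof. by move=> [H0 HB] Hx; rewrite -sub0r; apply: HB. Qed.

Lemma is_subgroupD H x y : is_subgroup H -> H x -> H y -> H (x + y).
Proof.
by move=> sH Hx Hy; rewrite -[y]opprK; apply: sH.2 => //; apply: is_subgroupN.
Qed.

Lemma is_subgroupMn H x n : is_subgroup H -> H x -> H (x *+ n).
Proof.
move=> sH Hx; elim: n => [|n IHn]; first by rewrite mulr0n; apply: sH.1.
by rewrite mulrS; apply: is_subgroupD.
Qed.

Lemma is_subgroup_sum {T : finType} H (F : T -> V) :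
  is_subgroup H -> (forall i, H (F i)) -> H (\sum_i F i).
Proof.
move=> sH HF; apply: (big_ind H); [exact: sH.1 | | by move=> i _; apply: HF].
by move=> x y; apply: is_subgroupD.
Qed.

Lemma is_subgroupI H K :
  is_subgroup H -> is_subgroup K -> is_subgroup (H `&` K).
Proof.
move=> [H0 HB] [K0 KB]; split=> // x y [Hx Kx] [Hy Ky].
by split; [apply: HB | apply: KB].
Qed.

Lemma is_subgroup_mulrn H m :
  is_subgroup H -> is_subgroup [set x *+ m | x in H].
Proof.
move=> sH; split; first by exists 0; [exact: sH.1 | rewrite mul0rn].
move=> _ _ [x Hx <-] [y Hy <-]; exists (x - y); first exact: sH.2.
by rewrite mulrnBl.
Qed.

(** Bézout: if [u * m = v * n + 1], then [x = u (m x) - v (n x)]. *)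
Lemma subgroup_coprime H x m n :
  is_subgroup H -> coprime m n -> H (x *+ m) -> H (x *+ n) -> H x.
Proof.
move=> sH; case: m => [|m] cmn Hm Hn.
  (* [egcdnP] wants a positive first coefficient; for [m = 0] coprimality forces [n = 1]. *)
  by move: cmn Hn; rewrite /coprime gcd0n => /eqP->; rewrite mulr1n.
have [u v uv _] := egcdnP n (ltn0Sn m).
rewrite (eqP cmn) in uv.
have -> : x = x *+ m.+1 *+ u - x *+ n *+ v.
  rewrite -!mulrnA mulnC uv mulrnDr mulr1n.
  by rewrite [(v * n)%N]mulnC addrAC subrr add0r.
by apply: sH.2; apply: is_subgroupMn.
Qed.

Lemma coset_eq H x y : is_subgroup H ->
  H (x - y) <-> [set x + z | z in H] = [set y + z | z in H].
Proof.
move=> sH; split=> [Hxy | xy].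
  apply/seteqP; split=> _ [z Hz <-] /=.
    exists (x - y + z); first exact: is_subgroupD.
    by rewrite addrA [y + _]addrC subrK.
  exists (z - (x - y)); first exact: sH.2.
  by rewrite opprB addrCA [x + _]addrC subrK addrC.
have : [set y + z | z in H] x.
  by rewrite -xy /=; exists 0; [exact: sH.1 | rewrite addr0].
by move=> [z Hz <-]; rewrite addrC addKr.
Qed.

Lemma transversal_index {T : finType} (r : T -> V) G H :
  is_subgroup H -> transversal r G H -> has_index G H #|T|.
Proof.
move=> sH [rG rI rS].
pose c i := [set r i + y | y in H].
have cE : cosets G H = [set c i | i in [set: T]].
  apply/seteqP; split=> [_ [x Gx <-]|_ [i _ <-]] /=; last by exists (r i).
  by have [i Hi] := rS _ Gx; exists i => //; apply/esym/coset_eq.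
have cI : injective c by move=> i j cij; apply/rI/(coset_eq _ _ sH).
have cF : finite_set (cosets G H) by rewrite cE; apply: finite_image.
split; first exact: cF.
rewrite /index_in.
have -> : fset_set (cosets G H) = [fset c i | i in T]%fset.
  apply/fsetP => C; rewrite in_fset_set //; apply/idP/imfsetP.
    by rewrite inE cE => -[i _ <-]; exists i.
  by move=> [i _ ->]; rewrite inE cE; exists i.
by rewrite card_imfset // cardE.
Qed.

Lemma index_transversal G H m : is_subgroup H -> has_index G H m ->
  exists r : 'I_m -> V, transversal r G H.
Proof.
move=> sH [fGH mE].
have mem i : (i < m)%N -> cosets G H (nth set0 (fset_set (cosets G H)) i).
  move=> im.
  have : nth set0 (fset_set (cosets G H)) i \in fset_set (cosets G H).
    by rewrite mem_nth // -[size _]/(index_in G H) mE.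
  by rewrite in_fset_set // inE.
have /choice[r rP] (i : 'I_m) : exists x, G x /\
    nth set0 (fset_set (cosets G H)) i = [set x + y | y in H].
  by have [x Gx <-] := mem i (ltn_ord i); exists x.
exists r; split=> [i|i j|x Gx]; first by have [] := rP i.
  move=> /(coset_eq _ _ sH); rewrite -(rP i).2 -(rP j).2 => /eqP.
  rewrite nth_uniq ?fset_uniq // -?[size _]/(index_in G H) ?mE //.
  by move=> /eqP ij; apply: val_inj.
have : [set x + y | y in H] \in fset_set (cosets G H).
  by rewrite in_fset_set // inE; exists x.
move=> /(nthP set0)[i]; rewrite -[size _]/(index_in G H) mE => im xE.
by exists (Ordinal im); apply/coset_eq => //; rewrite -xE -(rP (Ordinal im)).2.
Qed.

Lemma index_unique G H m n : has_index G H m -> has_index G H n -> m = n.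
Proof. by move=> [_ <-] [_ <-]. Qed.

Lemma index_gt0 G H m : is_subgroup G -> is_subgroup H ->
  has_index G H m -> (0 < m)%N.
Proof.
move=> sG sH /(index_transversal sH)[r [_ _ rS]].
by have [i _] := rS _ sG.1; apply: leq_trans (ltn_ord i).
Qed.

(* Translation by [x] permutes the cosets, so adding [x] to every representative
   changes the sum of the representatives only by an element of [H]. *)
Lemma index_mulrn G H m x : is_subgroup G -> is_subgroup H ->
  has_index G H m -> G x -> H (x *+ m).
Proof.
move=> sG sH /(index_transversal sH)[r [rG rI rS]] Gx.
have /choice[f fP] i : exists j, H (x + r i - r j).
  by apply: rS; apply: is_subgroupD.
have fI : injective f.
  move=> i j fij; apply: rI.
  have -> : r i - r j = x + r i - r (f i) - (x + r j - r (f j)).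
    by rewrite fij opprB addrA subrK opprD addrA [x + _]addrC addrK.
  exact: sH.2.
have : H (\sum_i (x + r i - r (f i))) by apply: is_subgroup_sum.
rewrite sumrB big_split /= sumr_const card_ord.
by rewrite [\sum_i r i](reindex_inj fI) addrK.
Qed.

(** Sums of a representative of [G] modulo [H] and one of [H] modulo [K] represent [G] modulo
    [K]. *)
Lemma index_tower G H K m n : is_subgroup G -> is_subgroup H -> is_subgroup K ->
  K `<=` H -> H `<=` G -> has_index G H m -> has_index H K n ->
  has_index G K (m * n).
Proof.
move=> sG sH sK KH HG /(index_transversal sH)[r [rG rI rS]].
move=> /(index_transversal sK)[s [sG' sI sS]].
have := @transversal_index _ (fun p : 'I_m * 'I_n => r p.1 + s p.2) G K sK.
rewrite card_prod !card_ord; apply; split.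
- by move=> [i j] /=; apply: is_subgroupD => //; apply: HG.
- move=> [i j] [i' j'] /= Kij.
  have ii' : i = i'.
    apply: rI.
    have -> : r i - r i' = (r i + s j - (r i' + s j')) + (s j' - s j).
      by rewrite opprD [_ + s j + _]addrACA -[s j' - _]opprB addrK.
    by apply: is_subgroupD => //; [apply: KH | apply: sH.2].
  rewrite ii' in Kij *; congr pair; apply: sI.
  by move: Kij; rewrite opprD addrACA subrr add0r.
- move=> x Gx; have [i Hi] := rS _ Gx; have [j Kj] := sS _ Hi.
  by exists (i, j); rewrite /= opprD addrA.
Qed.

(** Representatives that may repeat a coset still give finiteness and an upper bound. *)
Lemma cover_index {T : finType} (r : T -> V) G H : is_subgroup H ->
  (forall x, G x -> exists i, H (x - r i)) ->
  exists2 m, (m <= #|T|)%N & has_index G H m.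
Proof.
move=> sH rS; pose c i := [set r i + y | y in H].
have cS : cosets G H `<=` [set` [fset c i | i in T]%fset].
  move=> _ [x Gx <-]; have [i Hi] := rS _ Gx.
  by apply/imfsetP; exists i => //; apply/coset_eq.
have cF : finite_set (cosets G H) := sub_finite_set cS (finite_fset _).
exists (index_in G H) => //.
apply: (@leq_trans #|` [fset c i | i in T]%fset|%N).
  rewrite -[X in (_ <= #|` X|)%N]set_fsetK.
  by apply: fsubset_leq_card; rewrite -fset_set_sub // finite_fset.
by rewrite (leq_trans (leq_imfset_card _ _ _)) //= cardE.
Qed.

(** The cosets counted are those [x + K] with [x] in [H]; for general [K] their number is the index
    of [H ∩ K] in [H], as [index_capr] makes precise. *)
Lemma sub_index G H K m : is_subgroup K -> H `<=` G -> has_index G K m ->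
  exists2 k, (k <= m)%N & has_index H K k.
Proof.
move=> sK HG /(index_transversal sK)[r [_ _ rS]].
have [x Hx|k] := @cover_index _ r H K sK; first by apply: rS; apply: HG.
by rewrite card_ord; exists k.
Qed.

Lemma quo_index G H K m : is_subgroup H -> is_subgroup K -> K `<=` H ->
  has_index G K m -> exists k, has_index G H k.
Proof.
move=> sH sK KH /(index_transversal sK)[r [_ _ rS]].
have [|k _ kE] := @cover_index _ r G H sH; last by exists k.
by move=> x Gx; have [i Ki] := rS _ Gx; exists i; apply: KH.
Qed.

Lemma index_capr G H K m : is_subgroup H -> is_subgroup K -> H `<=` G ->
  has_index G K m -> exists2 k, (k <= m)%N & has_index H (H `&` K) k.
Proof.
move=> sH sK HG /(sub_index sK HG)[k km Hk]; exists k => //.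
have [r [rG rI rS]] := index_transversal sK Hk.
have sHK : is_subgroup (H `&` K) by apply: is_subgroupI.
rewrite -[k]card_ord; apply: (@transversal_index _ r) => //; split=> //.
  by move=> i j [_ Kij]; apply: rI.
by move=> x Hx; have [i Ki] := rS _ Hx; exists i; split=> //; apply: sH.2.
Qed.

(** With [k = [H : H ∩ K]] and [l = [K : H ∩ K]], the towers through [H] and [K] give [m k = n l].
    Hence [n] divides [k] by coprimality, while [k <= n], so [k = n]. *)
Lemma index_coprime G H K m n : is_subgroup G -> is_subgroup H ->
  is_subgroup K -> H `<=` G -> K `<=` G -> coprime m n ->
  has_index G H m -> has_index G K n -> has_index G (H `&` K) (m * n).
Proof.
move=> sG sH sK HG KG cmn iH iK.
have sHK : is_subgroup (H `&` K) by apply: is_subgroupI.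
have [k kn ik] := index_capr sH sK HG iK.
have [l _ il] := index_capr sK sH KG iH.
rewrite setIC in il.
have GHK := index_tower sG sH sHK (@subIsetl _ _ _) HG iH ik.
have GKH := index_tower sG sK sHK (@subIsetr _ _ _) KG iK il.
have k0 := index_gt0 sH sHK ik.
suff -> : n = k by [].
apply/eqP; rewrite eqn_leq kn andbT dvdn_leq // -(Gauss_dvdr k (n := m)).
  by rewrite (index_unique GHK GKH) dvdn_mulr.
by rewrite coprime_sym.
Qed.

End Index.

Lemma index_image {V W : zmodType} (f : {additive V -> W}) (G H : set V) m :
  injective f -> is_subgroup H -> has_index G H m ->
  has_index (f @` G) (f @` H) m.
Proof.
move=> fI sH /(index_transversal sH)[r [rG rI rS]].
have sfH : is_subgroup (f @` H).
  split; first by exists 0; [exact: sH.1 | rewrite raddf0].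
  move=> _ _ [x Hx <-] [y Hy <-]; exists (x - y); first exact: sH.2.
  by rewrite raddfB.
rewrite -[m]card_ord; apply: (@transversal_index _ _ (f \o r)) => //.
split=> /=.
- by move=> i; exists (r i).
- by move=> i j [x Hx]; rewrite -raddfB => /fI xE; apply: rI; rewrite -xE.
- move=> _ [x Gx <-]; have [i Hi] := rS _ Gx; exists i.
  by exists (x - r i) => //; rewrite raddfB.
Qed.

(** * Determinants as indices of integer spans *)

(** The Smith form [N = L D Q], with [L] and [Q] unimodular, reduces the count to the diagonal
    matrix [D], whose cokernel is a product of cyclic groups of orders [|s_i|]. *)
Lemma int_submodule_index d (N : 'M[int]_d) : \det N != 0 ->
  has_index [set: 'cV[int]_d] [set N *m z | z in [set: 'cV[int]_d]] `|\det N|.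
Proof.
move=> N0.
have [L uL [Q uQ [s _ NE]]] := int_Smith_normal_form N.
set D := (\matrix_(i, j) _) in NE.
have detD : \det D = \prod_(i < d) s`_i.
  rewrite det_trig; last first.
    apply/is_trig_mxP => i j ij; rewrite mxE; case: eqP => // ji.
    by rewrite ji ltnn in ij.
  by apply: eq_bigr => i _; rewrite mxE eqxx.
have detN : `|\det N|%N = (\prod_(i < d) `|(s`_i)%R|)%N.
  have absu (M : 'M[int]_d) : M \in unitmx -> `|\det M|%N = 1%N.
    by rewrite unitmxE => /orP[] /eqP ->.
  rewrite NE !det_mulmx !abszM (absu L) // (absu Q) // mul1n muln1 detD.
  exact: (big_morph absz abszM absz1).
have s0 (i : 'I_d) : s`_i != 0.
  apply: contraNneq N0 => si0; rewrite NE !det_mulmx detD (bigD1 i) //= si0.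
  by rewrite mul0r mulr0 mul0r.
have DE (w : 'cV[int]_d) i : (D *m w) i 0 = s`_i * w i 0.
  rewrite mxE (bigD1 i) //= big1 ?addr0 ?mxE ?eqxx // => j ji.
  by rewrite mxE val_eqE eq_sym (negbTE ji) mul0r.
(* Representatives: [L] applied to the vectors whose entry [i] is a residue in [0 .. |s_i| - 1]. *)
pose r (f : {dffun forall i : 'I_d, 'I_`|(s`_i)%R|}) : 'cV[int]_d :=
  L *m \col_i (f i)%:Z.
have -> : `|\det N|%N = #|{dffun forall i : 'I_d, 'I_`|(s`_i)%R|}|.
  rewrite card_dep_ffun detN foldrE big_map big_enum /=.
  by apply: eq_bigr => i _; rewrite card_ord.
apply: (@transversal_index _ _ r).
  split; first by exists 0; rewrite ?mulmx0.
  by move=> _ _ [x _ <-] [y _ <-]; exists (x - y); rewrite ?mulmxBr.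
split=> // [f g [z _]|x _].
  rewrite NE /r -mulmxBr -!mulmxA => /(can_inj (mulKmx uL)) E.
  apply/ffunP => i; apply/val_inj/eqP; rewrite -eqz_nat -subr_eq0.
  move/(congr1 (fun v : 'cV_d => v i 0)): E; rewrite DE !mxE => E.
  have fi := ltn_ord (f i); have gi := ltn_ord (g i).
  have : (s`_i %| (f i)%:Z - (g i)%:Z)%Z by rewrite -E dvdz_mulr.
  (* A nonzero multiple of [s_i] has absolute value at least [|s_i|], but two residues differ by
     less. *)
  rewrite -absz_eq0 => /dvdn_leq; case: posnP => // ? /(_ isT); lia.
have [y ->] : exists y, x = L *m y by exists (invmx L *m x); rewrite mulKVmx.
(* Divide each entry of [y] by [s_i]: the remainders select the representative, and [Q^-1] applied
   to the quotients is the preimage under [N]. *)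
have fP (i : 'I_d) : (`|(y i 0%R %% s`_i)%Z| < `|(s`_i)%R|)%N.
  by rewrite -ltz_nat gez0_abs ?modz_ge0 // ltz_mod.
pose f : {dffun forall i : 'I_d, 'I_`|(s`_i)%R|} := [ffun i => Ordinal (fP i)].
exists f; exists (invmx Q *m \col_i (y i 0%R %/ s`_i)%Z) => //.
rewrite NE -!mulmxA mulKVmx // /r -mulmxBr.
congr (_ *m _); apply/colP => i; rewrite DE !mxE ffunE /=.
rewrite gez0_abs ?modz_ge0 //.
by apply/esym/eqP; rewrite subr_eq mulrC -divz_eq.
Qed.

Definition int_span {R : realType} {d : nat} (B : 'M[R]_d) : set 'cV[R]_d :=
  [set B *m map_mx intr z | z in [set: 'cV[int]_d]].

Lemma is_subgroup_int_span (R : realType) d (B : 'M[R]_d) :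
  is_subgroup (int_span B).
Proof.
split; first by exists 0; rewrite // raddf0 mulmx0.
by move=> _ _ [x _ <-] [y _ <-]; exists (x - y); rewrite // raddfB mulmxBr.
Qed.

(** The injection [z ↦ B z] transports [int_submodule_index] to real spans. *)
Lemma int_span_index (R : realType) d (B : 'M[R]_d) (N : 'M[int]_d) :
  B \in unitmx -> \det N != 0 ->
  has_index (int_span B) (int_span (B *m map_mx intr N)) `|\det N|.
Proof.
move=> uB N0.
pose f : {additive 'cV[int]_d -> 'cV[R]_d} := mulmx B \o map_mx intr.
have fI : injective f.
  move=> x y /(can_inj (mulKmx uB)) /matrixP xy; apply/matrixP => i j.
  by move: (xy i j); rewrite !mxE => /intr_inj.
have -> : int_span (B *m map_mx intr N) =
    f @` [set N *m z | z in [set: 'cV[int]_d]].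
  apply/seteqP; split=> [_ [z _ <-]|_ [_ [z _ <-] <-]] /=.
    by exists (N *m z); [exists z | rewrite /= map_mxM mulmxA].
  by exists z; rewrite //= map_mxM mulmxA.
apply: (@index_image _ _ f setT) => //; last exact: int_submodule_index.
split; first by exists 0; rewrite ?mulmx0.
by move=> _ _ [x _ <-] [y _ <-]; exists (x - y); rewrite ?mulmxBr.
Qed.

(** * Orthogonal matrices *)

Lemma isometry_mx_unit (R : realType) d (Q : 'M[R]_d) :
  isometry_mx Q -> Q \in unitmx.
Proof. by move=> /mulmx1_unit[]. Qed.

Lemma isometry_mx_normr_det (R : realType) d (Q : 'M[R]_d) :
  isometry_mx Q -> `|\det Q| = 1.
Proof.
move=> /(congr1 determinant); rewrite det_mulmx det_tr det1 -expr2 => dQ.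
by apply/eqP; rewrite -sqrp_eq1 // -normrX dQ normr1.
Qed.

Lemma isometry_mxM (R : realType) d (P Q : 'M[R]_d) :
  isometry_mx P -> isometry_mx Q -> isometry_mx (P *m Q).
Proof.
move=> iP iQ; rewrite /isometry_mx trmx_mul mulmxA -[_ *m P]mulmxA iP.
by rewrite mulmx1.
Qed.

(** * Lattices and the coincidence site lattice of one isometry *)

Section Lattice.
Variables (R : realType) (d : nat).
Implicit Types (G : set 'cV[R]_d) (P Q B : 'M[R]_d).

Lemma is_subgroup_mulmx G Q :
  is_subgroup G -> is_subgroup [set Q *m x | x in G].
Proof.
move=> sG; split; first by exists 0; [exact: sG.1 | rewrite mulmx0].
move=> _ _ [x Gx <-] [y Gy <-]; exists (x - y); first exact: sG.2.
by rewrite mulmxBr.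
Qed.

Lemma index_mulmx G H Q m : Q \in unitmx -> is_subgroup H -> has_index G H m ->
  has_index [set Q *m x | x in G] [set Q *m x | x in H] m.
Proof.
by move=> uQ; apply: (@index_image _ _ (mulmx Q)); apply: can_inj (mulKmx uQ).
Qed.

Lemma is_subgroup_lattice G : is_lattice G -> is_subgroup G.
Proof. by move=> [B _ ->]; apply: is_subgroup_int_span. Qed.

Lemma is_subgroup_coincidence_site G Q :
  is_subgroup G -> is_subgroup (coincidence_site G Q).
Proof. by move=> sG; apply/is_subgroupI => //; apply: is_subgroup_mulmx. Qed.

(** Writing [k G] as the span of [B] times a scalar integer matrix makes its index a determinant,
    [k ^ d]. *)
Lemma int_span_scalar B (k : nat) :
  int_span (B *m map_mx intr k%:Z%:M) = [set x *+ k | x in int_span B].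
Proof.
have E (z : 'cV[int]_d) : B *m map_mx intr k%:Z%:M *m map_mx intr z =
    (B *m map_mx intr z) *+ k.
  by rewrite map_scalar_mx /= mul_mx_scalar -scalemxAl scaler_nat.
apply/seteqP; split=> [_ [z _ <-]|_ [_ [z _ <-] <-]] /=; last by exists z.
by exists (B *m map_mx intr z); [exists z | rewrite E].
Qed.

Lemma int_span_mulrn_index B (k : nat) : B \in unitmx -> (0 < k)%N ->
  has_index (int_span B) [set x *+ k | x in int_span B] (k ^ d).
Proof.
move=> uB k0; have := @int_span_index _ _ B k%:Z%:M uB.
rewrite det_scalar int_span_scalar abszX; apply.
by rewrite expf_neq0 // eqz_nat -lt0n.
Qed.

Lemma lattice_mulrn_index G (k : nat) : is_lattice G -> (0 < k)%N ->
  has_index G [set x *+ k | x in G] (k ^ d).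
Proof. by move=> [B uB ->]; apply: int_span_mulrn_index. Qed.

(* Both [G] and [Q G] contain [m G], and with the same index [m ^ d] because
   [Q] preserves volumes. *)
Lemma coincidence_site_index_image G Q m : is_lattice G -> isometry_mx Q ->
  has_index G (coincidence_site G Q) m ->
  has_index [set Q *m x | x in G] (coincidence_site G Q) m.
Proof.
move=> [B uB GE] iQ iG; have uQ := isometry_mx_unit iQ.
have sG : is_subgroup G by rewrite GE; apply: is_subgroup_int_span.
have sQG := is_subgroup_mulmx Q sG.
have sL := is_subgroup_coincidence_site Q sG.
have m0 := index_gt0 sG sL iG.
pose mG := [set x *+ m | x in G].
have sm : is_subgroup mG by apply: is_subgroup_mulrn.
have mL : mG `<=` coincidence_site G Q.
  by move=> _ [x Gx <-]; apply: index_mulrn iG Gx.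
have iGm : has_index G mG (m ^ d).
  by rewrite /mG GE; apply: int_span_mulrn_index.
have QGE : [set Q *m x | x in G] = int_span (Q *m B).
  rewrite GE; apply/seteqP; split=> [_ [_ [z _ <-] <-]|_ [z _ <-]] /=.
    by exists z; rewrite // mulmxA.
  by exists (B *m map_mx intr z); [exists z | rewrite mulmxA].
(* Since [m G] lies in [Q G], [m] times each column of [B] has integer coordinates in the columns of
   [Q B]. These coordinates form a matrix [N] with [m B = Q B N]. *)
have /choice[z zE] (j : 'I_d) :
    exists z : 'cV[int]_d, Q *m B *m map_mx intr z = col j B *+ m.
  have Gj : G (col j B).
    by rewrite GE; exists (delta_mx j 0); rewrite // map_delta_mx colE.
  have /mL[_] : mG (col j B *+ m) by exists (col j B).
  by rewrite QGE => -[z _ zE]; exists z.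
pose N := \matrix_(i, j) z j i 0.
have BmE : B *m map_mx intr m%:Z%:M = Q *m B *m map_mx intr N.
  rewrite map_scalar_mx /= mul_mx_scalar; apply/matrixP => i j.
  move/(congr1 (fun v : 'cV_d => v i 0)): (zE j).
  rewrite mulmxnE !mxE mulr_natl => <-; apply: eq_bigr => k _.
  by rewrite !mxE.
(* Take absolute determinants in [m B = Q B N]: [|det Q| = 1], and the nonzero [|det B|] cancels. *)
have detN : `|\det N|%N = (m ^ d)%N.
  apply/eqP; rewrite -(eqr_nat R) natrX natr_absz intr_norm.
  have := congr1 determinant BmE; rewrite !det_mulmx -!det_map_mx.
  rewrite map_scalar_mx det_scalar /= => /(congr1 Num.norm).
  rewrite !normrM (isometry_mx_normr_det iQ) mul1r => /mulfI <-.
    by rewrite normrX normr_nat.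
  by rewrite normr_eq0 -unitfE -unitmxE.
have iQm : has_index [set Q *m x | x in G] mG (m ^ d).
  have -> : mG = int_span (Q *m B *m map_mx intr N).
    by rewrite -BmE int_span_scalar /mG GE.
  rewrite QGE -detN; apply: int_span_index; first by rewrite unitmx_mul uQ.
  by rewrite -absz_eq0 detN -lt0n expn_gt0 m0.
(* With [L = G ∩ QG], [a = [L : m G]] and [b = [Q G : L]], the two towers give [m a = m ^ d = b a];
   cancelling [a > 0] yields [b = m]. *)
have [a _ iLm] :=
  sub_index (H := coincidence_site G Q) sm (@subIsetl _ _ _) iGm.
have [b iQL] := quo_index sL sm mL iQm.
have tG := index_tower sG sL sm mL (@subIsetl _ _ _) iG iLm.
have tQ := index_tower sQG sL sm mL (@subIsetr _ _ _) iQL iLm.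
have a0 := index_gt0 sL sm iLm.
have /eqP := index_unique iQm tQ.
rewrite (index_unique iGm tG) eqn_pmul2r // => /eqP mb.
by rewrite mb.
Qed.

(** * Products of two isometries with coprime indices *)

Section Product.
Variables (G : set 'cV[R]_d) (P Q : 'M[R]_d) (m n : nat).
Hypotheses (hG : is_lattice G) (iP : isometry_mx P) (iQ : isometry_mx Q).
Hypotheses (iGP : has_index G (coincidence_site G P) m)
  (iGQ : has_index G (coincidence_site G Q) n) (cmn : coprime m n).

Let sG := is_subgroup_lattice hG.
Let sPG := is_subgroup_mulmx P sG.
Let sLP := is_subgroup_coincidence_site P sG.
Let sLQ := is_subgroup_coincidence_site Q sG.
Let sLPQ := is_subgroup_coincidence_site (P *m Q) sG.
Let sPLQ := is_subgroup_mulmx P sLQ.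

(* For [x] in [G] and in [P Q G], the multiple [m x] lies in [P G] because [P G]
   meets [G] in index [m], and [n x] does because [P G] meets [P Q G] in index
   [n]. *)
Lemma coincidence_siteM_sub :
  coincidence_site G (P *m Q) `<=` [set P *m x | x in G].
Proof.
move=> x [Gx [y Gy yx]]; apply: (subgroup_coprime _ cmn) => //.
  by have [] := index_mulrn sG sLP iGP Gx.
have iQG := coincidence_site_index_image hG iQ iGQ.
have [|Gn _] := index_mulrn (x := Q *m y) (is_subgroup_mulmx Q sG) sLQ iQG.
  by exists y.
by exists (Q *m y *+ n); rewrite // raddfMn /= mulmxA yx.
Qed.

(** Once [x = P Q y] in [G] is known to equal some [P z] with [z] in [G], cancelling [P] gives
    [z = Q y], so [z] lies in [G ∩ QG]. *)
Lemma coincidence_siteM :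
  coincidence_site G (P *m Q) =
  coincidence_site G P `&` [set P *m x | x in coincidence_site G Q].
Proof.
apply/seteqP; split=> x.
  move=> Lx; have PGx := coincidence_siteM_sub Lx.
  case: Lx => Gx [y Gy yx]; split=> //; case: PGx => z Gz zx.
  exists z => //; split=> //; exists y => //.
  apply: (can_inj (mulKmx (isometry_mx_unit iP))).
  by rewrite mulmxA yx zx.
move=> [[Gx _] [_ [_ [y Gy <-]] Ex]]; split=> //.
by exists y; rewrite // -mulmxA.
Qed.

(** The index is first found inside [P G], where the two intersected subgroups have coprime indices
    [m] and [n]. It carries over to [G] because [G ∩ PG] has index [m] in both. *)
Lemma coincidence_siteM_index :
  has_index G (coincidence_site G (P *m Q)) (m * n).
Proof.
have LPL : coincidence_site G (P *m Q) `<=` coincidence_site G P.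
  by rewrite coincidence_siteM; apply: subIsetl.
have iPL := coincidence_site_index_image hG iP iGP.
have iPGL :
    has_index [set P *m x | x in G] (coincidence_site G (P *m Q)) (m * n).
  rewrite coincidence_siteM; apply: index_coprime => //.
  - exact: subIsetr.
  - by move=> _ [x [Gx _] <-]; exists x.
  - exact: index_mulmx (isometry_mx_unit iP) sLQ iGQ.
have [a _ iLL] := sub_index (H := coincidence_site G P) sLPQ
  (@subIsetr _ _ _) iPGL.
have tP := index_tower sPG sLP sLPQ LPL (@subIsetr _ _ _) iPL iLL.
rewrite (index_unique iPGL tP).
exact: index_tower sG sLP sLPQ LPL (@subIsetl _ _ _) iGP iLL.
Qed.

(** If [x = P y] with [y] in [G], then [n y] lies in [G ∩ QG]. Conversely [m x] and [n x] both lie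
    in [G ∩ PG], hence so does [x]. *)
Lemma coincidence_siteM_left : coincidence_site G P =
  [set x | G x /\ coincidence_site G (P *m Q) (x *+ n)].
Proof.
rewrite coincidence_siteM; apply/seteqP; split=> x.
  move=> Lx; have [Gx [y Gy yx]] := Lx; split=> //.
  split; first exact: is_subgroupMn.
  exists (y *+ n); first exact: index_mulrn iGQ Gy.
  by rewrite raddfMn /= yx.
move=> [Gx [Lnx _]]; apply: (subgroup_coprime _ cmn) => //.
exact: index_mulrn iGP Gx.
Qed.

(** For [x] in [G], [m P x] lies in [G ∩ PG], which has index [m] in [P G]. Conversely, cancelling
    [P] puts [m x] in [G ∩ QG], which contains [n x] as well. *)
Lemma coincidence_siteM_right : coincidence_site G Q =
  [set x | G x /\ coincidence_site G (P *m Q) (P *m x *+ m)].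
Proof.
have uP := isometry_mx_unit iP.
rewrite coincidence_siteM; apply/seteqP; split=> x.
  move=> Lx; split; first exact: Lx.1.
  have iPL := coincidence_site_index_image hG iP iGP.
  split; first by apply: index_mulrn sPG sLP iPL _; exists x => //; exact: Lx.1.
  by exists (x *+ m); [apply: is_subgroupMn | rewrite raddfMn].
move=> [Gx [_ [y Ly]]]; rewrite -raddfMn => /(can_inj (mulKmx uP)) yx.
apply: (subgroup_coprime _ cmn) => //; first by rewrite -yx.
exact: index_mulrn iGQ Gx.
Qed.

End Product.

(** * Finiteness of the counted sets and the inequality *)

(** A coincidence site lattice of index [m] contains [m G], so it is a union of cosets of [m G],
    determined by which of the [m ^ d] representatives it contains. *)
Lemma csl_of_index_finite G m : is_lattice G -> (0 < m)%N ->
  finite_set (csl_of_index G m).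
Proof.
move=> hG m0; have sG := is_subgroup_lattice hG.
pose mG := [set x *+ m | x in G].
have sm : is_subgroup mG by apply: is_subgroup_mulrn.
have [r [rG _ rS]] := index_transversal sm (lattice_mulrn_index hG m0).
pose U (S : {set 'I_(m ^ d)}) := [set x | exists2 i, i \in S & mG (x - r i)].
apply: (@sub_finite_set _ _ [set U S | S in setT]); last exact: finite_image.
move=> _ [Q [[iQ fQ] mE] <-].
have sL := is_subgroup_coincidence_site Q sG.
have mL : mG `<=` coincidence_site G Q.
  by move=> _ [x Gx <-]; apply: (index_mulrn sG sL) Gx.
exists [set i | `[< coincidence_site G Q (r i) >]]%SET => //.
apply/seteqP; split=> x.
  move=> [i]; rewrite finset.inE => /asboolP Li /mL Lxi.
  by rewrite -[x](subrK (r i)); apply: is_subgroupD.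
move=> Lx; have [i xi] := rS _ Lx.1; exists i => //.
rewrite finset.inE; apply/asboolP; rewrite -[r i](subKr x).
by apply: sL.2 => //; apply: mL.
Qed.

End Lattice.

Unset Implicit Arguments.

Theorem theorem5 (R : realType) (d : nat) (G : set 'cV[R]_d)
    (hG : is_lattice G) (m n : nat) (hm : (0 < m)%N) (hn : (0 < n)%N)
    (hmn : coprime m n) :
  (csl_count G m * csl_count G n <= csl_count G (m * n))%N.
Proof.
(* Fix one isometry for each pair of an index and a lattice; pairs that do not occur get the zero
   matrix. *)
have /choice[rho rhoP] (p : nat * set 'cV[R]_d) :
    exists Q, csl_of_index G p.1 p.2 ->
    [/\ isometry_mx Q, has_index G (coincidence_site G Q) p.1 &
        coincidence_site G Q = p.2].
  have [[Q [[iQ fQ] mE] <-]|nL] := pselect (csl_of_index G p.1 p.2).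
    by exists Q.
  by exists 0.
pose F L1 L2 := coincidence_site G (rho (m, L1) *m rho (n, L2)).
have fm := csl_of_index_finite hG hm.
have fn := csl_of_index_finite hG hn.
have fmn : finite_set (csl_of_index G (m * n)).
  by apply: csl_of_index_finite; rewrite // muln_gt0 hm.
have FI L1 L2 L1' L2' : csl_of_index G m L1 -> csl_of_index G n L2 ->
    csl_of_index G m L1' -> csl_of_index G n L2' ->
    F L1 L2 = F L1' L2' -> L1 = L1' /\ L2 = L2'.
  move=> /(rhoP (m, L1))[iP iGP PE] /(rhoP (n, L2))[iQ iGQ QE].
  move=> /(rhoP (m, L1'))[iP' iGP' PE'] /(rhoP (n, L2'))[iQ' iGQ' QE'] FE.
  have E1 : L1 = L1'.
    rewrite -[L1]PE -[L1']PE' /=.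
    rewrite (coincidence_siteM_left hG iP iQ iGP iGQ hmn).
    rewrite (coincidence_siteM_left hG iP' iQ' iGP' iGQ' hmn).
    by rewrite -/(F L1 L2) FE.
  (* Both products now have the same left factor [rho (m, L1)], on which the description of the
     right factor depends. *)
  subst L1'; split=> //; rewrite -[L2]QE -[L2']QE' /=.
  rewrite (coincidence_siteM_right hG iP iQ iGP iGQ hmn).
  rewrite (coincidence_siteM_right hG iP' iQ' iGP' iGQ' hmn).
  by rewrite -/(F L1 L2) FE.
(* The list of all [F L1 L2] is duplicate-free by [FI], and its entries are coincidence site
   lattices of index [m * n]. *)
rewrite /csl_count -(size_allpairs F); apply: uniq_leq_size.
  apply: allpairs_uniq; rewrite ?fset_uniq // => -[L1 L2] [L1' L2'].
  move=> /allpairsP[[? ?] /= [h1 h2 [-> ->]]].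
  move=> /allpairsP[[? ?] /= [h1' h2' [-> ->]]] FE.
  rewrite !in_fset_set // !inE in h1 h2 h1' h2'.
  by have [-> ->] := FI _ _ _ _ h1 h2 h1' h2' FE.
move=> _ /allpairsP[[L1 L2] /= [+ + ->]]; rewrite !in_fset_set // !inE.
move=> /(rhoP (m, L1))[iP iGP _] /(rhoP (n, L2))[iQ iGQ _].
exists (rho (m, L1) *m rho (n, L2)) => //.
have [fi im] := coincidence_siteM_index hG iP iQ iGP iGQ hmn.
by split=> //; split=> //; apply: isometry_mxM.
Qed.
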